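(* Let $(\Omega,\Sigma,\mu)$ be a measure space and $1<r<p<\infty$. There is a set $\Gamma$ of measures on $\Sigma$ such that $(L^{p,\infty}(\mu),\|\cdot\|_{L^{p,\infty}_r})$ lattice isometrically embeds into $(\bigoplus_{\nu\in\Gamma}(L^{p,\infty}(\nu),\|\cdot\|_{L^{p,\infty}_1}))_\infty$.
   Context: $L^{p,\infty}(\mu)$ is the space of measurable $f$ with $\sup_{t>0}t\,\mu(\{|f|>t\})^{1/p}<\infty$. For $1\le r<p$, $\|f\|_{L^{p,\infty}_r}=\sup_{0<\mu(A)<\infty}\mu(A)^{-\frac1r+\frac1p}(\int_A|f|^r\,d\mu)^{1/r}$; this is an equivalent lattice norm on $L^{p,\infty}(\mu)$. *)

(* Defs.v *)
From HB Require Import structures.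
From mathcomp Require Import all_boot all_order all_algebra.
From mathcomp Require Import all_classical all_reals all_analysis.
Set Implicit Arguments. Unset Strict Implicit. Unset Printing Implicit Defensive.
Import Order.TTheory GRing.Theory Num.Theory.
Local Open Scope classical_set_scope.
Local Open Scope ring_scope.

Section WeakLp.
Context {R : realType} {d : measure_display} {T : measurableType d}.

Definition weakLp_qnorm (mu : {measure set T -> \bar R}) (p : R) (f : T -> R)
  : \bar R :=
  ereal_sup [set (t%:E * poweR (mu [set x | (t < `|f x|)%R]) p^-1)%E
            | t in [set t : R | 0 < t]].

Definition weakLp (mu : {measure set T -> \bar R}) (p : R) (f : T -> R) : Prop :=
  measurable_fun setT f /\ (weakLp_qnorm mu p f < +oo)%E.

(* || f ||_{L^{p,oo}_r} = sup_{0 < mu A < oo} mu(A)^(-1/r+1/p) (int_A |f|^r)^(1/r);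
   the value 0 is adjoined so that the sup over an empty family is 0. *)
Definition weakLp_rnorm (mu : {measure set T -> \bar R}) (p r : R) (f : T -> R)
  : \bar R :=
  ereal_sup ([set 0%E] `|`
    [set ((fine (mu A)) `^ (p^-1 - r^-1))%:E *
         poweR (\int[mu]_(x in A) (`|f x| `^ r)%:E) r^-1
    | A in [set A : set T | measurable A /\ (0 < mu A < +oo)%E]])%E.

End WeakLp.

(* Main.v *)
Require Import Defs.
From HB Require Import structures.
From mathcomp Require Import all_boot all_order all_algebra.
From mathcomp Require Import all_classical all_reals all_analysis.
From mathcomp Require Import measurable_realfun simple_functions ring.
Import Order.TTheory GRing.Theory Num.Theory.
Import numFieldNormedType.Exports HBNNSimple.
Local Open Scope classical_set_scope.
Local Open Scope ring_scope.

(** Put [alpha = (1/r - 1/p) / (1 - 1/p)] and [beta = (1 - 1/r) / (1 - 1/p)],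
so [alpha + beta = 1]. For a function [phi >= 0] supported in a set of finite
measure, let [nu = h mu] with [h = alpha + beta * phi^r'] on that set ([r'] the
conjugate exponent of [r]), and let [f] be sent to [f * phi / h] in
[L^{p,oo}(nu)]. Hoelder's inequality bounds [int_B |f| phi dmu] by
[||f||_{L^{p,oo}_r} * mu(B)^(1/r - 1/p) * (int_B phi^r' dmu)^(1/r')], and the
weighted AM-GM inequality bounds the product of the last two factors by
[nu(B)^(1 - 1/p)]; hence these maps are contractions. Both inequalities are
equalities on [B = A] when [phi = c * |f|^(r - 1)] on [A] and
[int_A phi^r' dmu = mu(A)], so the supremum over all [phi] is the norm of [f].
Only bounded [phi] are used, with [|f|] truncated at [n] and [n -> oo]: the
weights [phi / h] and the densities [h] are then bounded and the maps
trivially preserve weak [L^p]. *)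

Set Implicit Arguments.
Unset Strict Implicit.

(** * Measures given by a density *)

Lemma exists_density_measure (R : realType) (d : measure_display)
  (T : measurableType d) (mu : {measure set T -> \bar R}) (h : T -> R) :
  measurable_fun setT h -> (forall x, 0 <= h x) ->
  exists nu : {measure set T -> \bar R},
    forall A, nu A = (\int[mu]_(x in A) (h x)%:E)%E.
Proof.
move=> mh h0; pose m A := (\int[mu]_(x in A) (h x)%:E)%E.
have m0 : m set0 = 0%E by rewrite /m integral_set0.
have mge0 A : (0 <= m A)%E by apply: integral_ge0 => x _; rewrite lee_fin.
have msa : semi_sigma_additive m.
  move=> F mF tF mUF.
  rewrite /m ge0_integral_bigcup//; last 2 first.
  - by apply/measurable_EFinP; exact: measurable_funTS.
  - by move=> x _; rewrite lee_fin.
  apply: is_cvg_ereal_nneg_natsum_cond => n _ _.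
  by apply: integral_ge0 => x _; rewrite lee_fin.
pose B := isMeasure.Build _ T R m m0 mge0 msa.
pose nu : {measure set T -> \bar R} := HB.pack m B.
by exists nu.
Qed.

(** On indicators this is the hypothesis on [nu]. Finite sums give it for the simple functions
    [nnsfun_approx], and monotone convergence on both sides gives it for [f]. *)
Lemma ge0_integral_density (R : realType) (d : measure_display)
  (T : measurableType d) (mu nu : {measure set T -> \bar R}) (h : T -> R)
  (f : T -> \bar R) (E : set T) :
  measurable_fun setT h -> (forall x, 0 <= h x) ->
  (forall A, measurable A -> nu A = (\int[mu]_(x in A) (h x)%:E)%E) ->
  measurable E -> measurable_fun E f -> (forall x, 0 <= f x)%E ->
  (\int[nu]_(x in E) f x = \int[mu]_(x in E) (f x * (h x)%:E))%E.
Proof.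
move=> mh h0 nuE mE mf f0.
have mhE : measurable_fun E (fun x => (h x)%:E).
  by apply/measurable_EFinP; exact: measurable_funTS.
pose g := nnsfun_approx mE mf.
have gx x : E x -> ((g n x)%:E @[n --> \oo] --> f x)%E.
  by move=> Ex; exact: cvg_nnsfun_approx.
have gnd x : {homo (fun n => g n x) : a b / (a <= b)%N >-> a <= b}.
  by move=> a b ab; exact/lefP/nd_nnsfun_approx.
have mg n : measurable_fun E (fun x => (g n x)%:E).
  by apply/measurable_EFinP; exact: measurable_funTS.
have indicE y n : (\int[nu]_(x in E) (y * \1_(g n @^-1` [set y]) x)%:E =
   \int[mu]_(x in E) (y * \1_(g n @^-1` [set y]) x * h x)%:E)%E.
  (* The scalar can be pulled out of the integrals only when it is nonnegative. A negative [y] is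
     not a value of [g n], so its level set is empty and both sides are 0. *)
  have [y0|y0] := ltP y 0.
    rewrite !integral0_eq// => x _; rewrite preimage_nnfun0// indicE in_set0.
      by rewrite mulr0 mul0r.
    by rewrite mulr0.
  have mA : measurable (g n @^-1` [set y]) by [].
  under eq_integral do rewrite EFinM.
  under [RHS]eq_integral do rewrite -mulrA EFinM.
  have m1 : measurable_fun E (fun x => (\1_(g n @^-1` [set y]) x * h x)%:E).
    by apply/measurable_EFinP/measurable_funTS/measurable_funM.
  have m2 : measurable_fun E (fun x => (\1_(g n @^-1` [set y]) x)%:E : \bar R).
    by apply/measurable_EFinP/measurable_funTS.
  rewrite ge0_integralZl// [RHS]ge0_integralZl//; last first.
    by move=> x _; rewrite lee_fin mulr_ge0.
  rewrite integral_indic//; congr (_ * _)%E.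
  rewrite nuE; last exact: measurableI.
  rewrite setIC integral_mkcondr; apply: eq_integral => x _.
  by rewrite epatch_indic muleC -EFinM.
have gE n : (\int[nu]_(x in E) (g n x)%:E = \int[mu]_(x in E) (g n x * h x)%:E)%E.
  under eq_integral do rewrite fimfunE -fsumEFin//.
  rewrite ge0_integral_fsum//; last 2 first.
  - by move=> y; apply/measurable_EFinP; apply: measurable_funM => //; exact: measurable_funTS.
  - by move=> y x _; rewrite EFinM nnfun_muleindic_ge0.
  under [RHS]eq_integral.
    move=> x _; rewrite fimfunE EFinM -fsumEFin// ge0_mule_fsuml; last first.
      by move=> y; rewrite EFinM nnfun_muleindic_ge0.
    over.
  rewrite [RHS]ge0_integral_fsum//; last 2 first.
  - move=> y; under eq_fun do rewrite -EFinM.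
    apply/measurable_EFinP; apply: measurable_funM; last exact: measurable_funTS.
    by apply: measurable_funM => //; exact: measurable_funTS.
  - by move=> y x _; rewrite mule_ge0 ?lee_fin// -lee_fin EFinM nnfun_muleindic_ge0.
  by apply: eq_fsbigr => y _; rewrite indicE; apply: eq_integral => x _; rewrite EFinM.
transitivity (limn (fun n => \int[nu]_(x in E) (g n x)%:E))%E.
  rewrite -monotone_convergence//.
  - by apply: eq_integral => x /[!inE] xE; apply/esym/cvg_lim => //; exact: gx.
  - by move=> n x _; rewrite lee_fin.
  - by move=> x _ a b ab; rewrite lee_fin gnd.
under eq_fun do rewrite gE.
rewrite -monotone_convergence//.
- apply: eq_integral => x /[!inE] xE; apply/cvg_lim => //.
  by under eq_fun do rewrite EFinM; apply: cvgeZr => //; exact: gx.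
- by move=> n; apply/measurable_EFinP; apply: measurable_funM; exact: measurable_funTS.
- by move=> n x _; rewrite lee_fin mulr_ge0.
- by move=> x _ a b ab; rewrite lee_fin ler_wpM2r// gnd.
Qed.

(** * Weighted AM-GM, Hoelder on a set, truncation *)

(** Young's inequality with conjugate exponents [(u + v) / u] and [(u + v) / v], raised to the power
    [u + v]. *)
Lemma powR_weighted_AMGM (R : realType) (a b u v : R) :
  0 <= a -> 0 <= b -> 0 < u -> 0 < v ->
  a `^ u * b `^ v <= (u / (u + v) * a + v / (u + v) * b) `^ (u + v).
Proof.
move=> a0 b0 u0 v0; have w0 : 0 < u + v by rewrite addr_gt0.
have wE z c : c `^ z = (c `^ (z / (u + v))) `^ (u + v).
  by rewrite -powRrM divfK// gt_eqF.
rewrite (wE u a) (wE v b) -powRM ?powR_ge0//.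
apply: ge0_ler_powR; rewrite ?nnegrE ?mulr_ge0 ?powR_ge0 ?(ltW w0)//.
  by rewrite addr_ge0// mulr_ge0// divr_ge0// ltW.
have := @conjugate_powR R (a `^ (u / (u + v))) (b `^ (v / (u + v)))
  ((u + v) / u) ((u + v) / v).
rewrite !powR_ge0 => /(_ isT isT); rewrite !divr_gt0// => /(_ isT isT).
rewrite !invf_div -mulrDl divff ?gt_eqF// => /(_ erefl).
have wV z : 0 < z -> z / (u + v) * ((u + v) / z) = 1.
  by move=> z0; rewrite mulrA divfK ?divff// gt_eqF.
by rewrite -!powRrM !wV// !powRr1// [a * _]mulrC [b * _]mulrC.
Qed.

Lemma hoelder_on (R : realType) (d : measure_display) (T : measurableType d)
  (mu : {measure set T -> \bar R}) (f g : T -> R) (r s : R) (D : set T) :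
  measurable D -> measurable_fun D f -> measurable_fun D g ->
  0 < r -> 0 < s -> r^-1 + s^-1 = 1 ->
  (\int[mu]_(x in D) (`|f x| * `|g x|)%:E <=
   poweR (\int[mu]_(x in D) (`|f x| `^ r)%:E) r^-1 *
   poweR (\int[mu]_(x in D) (`|g x| `^ s)%:E) s^-1)%E.
Proof.
move=> mD mf mg r0 s0 rs.
have mp (k : T -> R) : measurable_fun D k -> measurable_fun setT (k \_ D).
  by move=> mk; apply/(measurable_restrictT k mD).
have := hoelder mu (mp _ mf) (mp _ mg) r0 s0 rs.
have N (k : T -> R) q : 0 < q -> Lnorm mu q%:E (EFin \o k \_ D) =
   poweR (\int[mu]_(x in D) (`|k x| `^ q)%:E)%E q^-1.
  move=> q0; rewrite unlock; congr poweR.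
  rewrite [RHS]integral_mkcond; apply: eq_integral => x _ /=.
  rewrite !patchE; case: ifP => // _.
  by rewrite normr0 powR0// gt_eqF.
rewrite !N// Lnorm1; apply: le_trans.
rewrite integral_mkcond le_eqVlt; apply/orP; left; apply/eqP.
apply: eq_integral => x _ /=; rewrite !patchE; case: ifP => _.
  by rewrite normrM.
by rewrite mul0r normr0.
Qed.

Lemma integral_powR_truncation_le (R : realType) (d : measure_display)
  (T : measurableType d) (mu : {measure set T -> \bar R}) (f : T -> R)
  (A : set T) (r : R) (K : \bar R) :
  measurable A -> measurable_fun A f -> 0 < r ->
  (forall n : nat,
    \int[mu]_(x in A) (Num.min `|f x| n%:R `^ r)%:E <= K)%E ->
  (\int[mu]_(x in A) (`|f x| `^ r)%:E <= K)%E.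
Proof.
move=> mA mf r0 bK.
pose g n x := ((Num.min `|f x| n%:R) `^ r)%:E.
have gcvg x : (g n x @[n --> \oo] --> (`|f x| `^ r)%:E)%E.
  apply: cvg_near_cst; near=> n; rewrite /g min_l//.
  by near: n; exact: nbhs_infty_ger.
have gnd x : {homo (fun n => g n x) : a b / (a <= b)%N >-> (a <= b)%E}.
  move=> a b ab; rewrite lee_fin ge0_ler_powR ?nnegrE ?le_min ?normr_ge0 ?ler0n ?(ltW r0)//.
  by rewrite ge_min lexx/= ge_min ler_nat ab orbT.
have mg n : measurable_fun A (g n).
  apply/measurable_EFinP; apply: (measurableT_comp (measurable_powR _)).
  by apply: measurable_minr => //; exact: measurableT_comp.
have g0 n x : (0 <= g n x)%E by rewrite lee_fin powR_ge0.
have -> : (\int[mu]_(x in A) (`|f x| `^ r)%:E =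
   limn (fun n => \int[mu]_(x in A) g n x))%E.
  rewrite -monotone_convergence//.
  by apply: eq_integral => x _; apply/esym/cvg_lim.
apply: lime_le; last by apply: nearW => n; exact: bK.
apply: ereal_nondecreasing_is_cvgn => a b ab.
by apply: ge0_le_integral => // x _; exact: gnd.
Unshelve. all: end_near. Qed.

(** * Admissible densities and their weights *)

Section weighted_embedding.
Context (R : realType) (d : measure_display) (T : measurableType d).
Context (mu : {measure set T -> \bar R}) (r p : R).
Hypotheses (r1 : 1 < r) (rp : r < p).

Definition alpha : R := (r^-1 - p^-1) / (1 - p^-1).
Definition beta : R := (1 - r^-1) / (1 - p^-1).
(* [phi] as a function of the value [y] of the density [h], for [y >= alpha]. *)
Definition dual_factor (y : R) : R := ((y - alpha) / beta) `^ (1 - r^-1).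
(* Division by zero makes the weight vanish off the support of the density. *)
Definition weight (y : R) : R := dual_factor y / y.

(** The gap between 0 and [alpha] bounds the weight and makes [mu] finite on any part of the support
    where [nu] is finite. Integrability makes the density of a measure unique almost everywhere. The
    upper bound [K] keeps weak L^p stable. *)
Definition admissible (h : T -> R) :=
  [/\ measurable_fun setT h, mu.-integrable setT (EFin \o h),
      forall x, h x = 0 \/ alpha <= h x &
      exists K, forall x, h x <= K].

Definition is_density (nu : {measure set T -> \bar R}) (h : T -> R) :=
  forall A, measurable A -> nu A = (\int[mu]_(x in A) (h x)%:E)%E.

Let r0 : 0 < r. Proof. by rewrite (lt_trans ltr01). Qed.
Let p1 : 1 < p. Proof. by rewrite (lt_trans r1). Qed.
Let p0 : 0 < p. Proof. by rewrite (lt_trans ltr01). Qed.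
Let u_gt0 : 0 < r^-1 - p^-1.
Proof. by rewrite subr_gt0 ltf_pV2. Qed.
Let v_gt0 : 0 < 1 - r^-1.
Proof. by rewrite subr_gt0 invf_lt1. Qed.
Let w_gt0 : 0 < 1 - p^-1.
Proof. by rewrite subr_gt0 invf_lt1. Qed.
Let uvw : (r^-1 - p^-1) + (1 - r^-1) = 1 - p^-1.
Proof. by ring. Qed.

Lemma alpha_gt0 : 0 < alpha. Proof. by rewrite divr_gt0. Qed.
Lemma beta_gt0 : 0 < beta. Proof. by rewrite divr_gt0. Qed.
Lemma alphaDbeta : alpha + beta = 1.
Proof. by rewrite -mulrDl uvw divff// gt_eqF. Qed.

Lemma admissible_ge0 h : admissible h -> forall x, 0 <= h x.
Proof.
by case=> _ _ hv _ x; case: (hv x) => [->//|]; apply: le_trans; exact/ltW/alpha_gt0.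
Qed.

Lemma weight_ge0 y : 0 <= y -> 0 <= weight y.
Proof. by move=> y0; rewrite divr_ge0// powR_ge0. Qed.

Lemma weightK y : y != 0 -> weight y * y = dual_factor y.
Proof. by move=> y0; rewrite /weight divfK. Qed.

Lemma dual_factor_powR y : alpha <= y ->
  dual_factor y `^ (1 - r^-1)^-1 = (y - alpha) / beta.
Proof.
move=> ay; rewrite -powRrM divff ?gt_eqF// powRr1//.
by rewrite divr_ge0 ?subr_ge0// ltW// beta_gt0.
Qed.

Lemma measurable_dual_factor (h : T -> R) : measurable_fun setT h ->
  measurable_fun setT (dual_factor \o h).
Proof.
move=> mh; apply: (measurableT_comp (measurable_powR _)).
by apply: measurable_funM => //; exact: measurable_funB.
Qed.

Lemma measurable_weight (h : T -> R) : measurable_fun setT h ->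
  (forall x, 0 <= h x) -> measurable_fun setT (weight \o h).
Proof.
move=> mh h0.
have -> : weight \o h = (fun x => dual_factor (h x) * h x `^ (-1)).
  by apply/funext => x; rewrite /= powR_inv1.
apply: measurable_funM; first exact: measurable_dual_factor.
exact: (measurableT_comp (measurable_powR _)).
Qed.

Lemma weight_bounded h : admissible h ->
  exists2 C, 0 < C & forall x, weight (h x) <= C.
Proof.
case=> _ _ hv [K hK].
(* [dual_factor] is increasing above [alpha] and [1 / y] is at most [1 / alpha] there. Adding
   [alpha] cancels the shift inside [dual_factor], and the maximum with 1 makes the constant
   positive. *)
exists (dual_factor (Num.max K 1 + alpha) / alpha) => [|x].
  rewrite divr_gt0 ?alpha_gt0// powR_gt0// divr_gt0 ?beta_gt0// addrK.
  by rewrite lt_max ltr01 orbT.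
have C0 : 0 <= dual_factor (Num.max K 1 + alpha) / alpha.
  by rewrite divr_ge0 ?powR_ge0// ltW// alpha_gt0.
case: (hv x) => [->|ah]; first by rewrite /weight invr0 mulr0.
have h0 : 0 < h x by exact: lt_le_trans alpha_gt0 ah.
apply: ler_pM; rewrite ?powR_ge0 ?invr_ge0 ?(ltW h0)//; last first.
  by rewrite lef_pV2// posrE ?alpha_gt0.
have hM : h x <= Num.max K 1 by rewrite le_max hK.
have b0 := beta_gt0; have a0 := alpha_gt0.
apply: ge0_ler_powR; rewrite ?nnegrE ?(ltW v_gt0)//.
- by rewrite divr_ge0// ?(ltW b0)// subr_ge0.
- by rewrite addrK divr_ge0 ?(ltW b0)// (le_trans (ltW h0)).
- by rewrite ler_pM2r ?invr_gt0// addrK lerBlDr (le_trans hM)// lerDl ltW.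
Qed.

(** * The weighted maps: weak L^p and contraction *)

Lemma weakLp_weight nu h f : admissible h -> is_density nu h ->
  weakLp mu p f -> weakLp nu p (fun x => f x * weight (h x)).
Proof.
move=> ah nuh [mf fq]; have h0 := admissible_ge0 ah.
have [C C0 hC] := weight_bounded ah.
have [mh _ _ [K hK]] := ah.
have mW := measurable_weight mh h0.
have mfW : measurable_fun setT (fun x => f x * weight (h x)).
  exact: measurable_funM.
split => //; pose L := Num.max K 1.
have L0 : 0 < L by rewrite lt_max ltr01 orbT.
apply: (@le_lt_trans _ _ ((C * L `^ p^-1)%:E * weakLp_qnorm mu p f)%E); last first.
  by apply: lte_mul_pinfty => //; rewrite lee_fin mulr_ge0 ?powR_ge0// ltW.
apply: ge_ereal_sup => _ [t /= t0 <-].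
set E := [set x | t < _].
have mE : measurable E.
  rewrite /E -[X in measurable X]setTI.
  by apply: measurable_fun_ltr => //; exact: measurableT_comp.
set F := [set x | t / C < `|f x|].
have mF : measurable F.
  rewrite /F -[X in measurable X]setTI.
  by apply: measurable_fun_ltr => //; exact: measurableT_comp.
have EF : E `<=` F.
  move=> x; rewrite /E /F /= normrM (ger0_norm (weight_ge0 (h0 x))) => tx.
  rewrite ltr_pdivrMr// (lt_le_trans tx)// ler_wpM2l//.
have nuE : (nu E <= L%:E * mu F)%E.
  rewrite nuh//; apply: (@le_trans _ _ (\int[mu]_(x in E) (cst L%:E x)))%E.
    apply: ge0_le_integral => //.
    - by move=> x _; rewrite lee_fin.
    - by apply/measurable_EFinP; exact: measurable_funTS.
    - by move=> x _; rewrite lee_fin le_max hK.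
  rewrite integral_cst//; apply: lee_wpmul2l; first by rewrite lee_fin ltW.
  by rewrite le_measure ?inE.
apply: (@le_trans _ _ (t%:E * poweR (L%:E * mu F) p^-1)%E).
  apply: lee_wpmul2l; first by rewrite lee_fin ltW.
  apply: gt0_ler_poweR; rewrite ?invr_ge0 ?(ltW p0)//.
  - by rewrite in_itv/= measure_ge0 leey.
  - by rewrite in_itv/= mule_ge0 ?leey// lee_fin ltW.
rewrite poweRM ?lee_fin ?(ltW L0)// poweR_EFin.
have -> : (t%:E * ((L `^ p^-1)%:E * poweR (mu F) p^-1) =
   (C * L `^ p^-1)%:E * ((t / C)%:E * poweR (mu F) p^-1))%E.
  rewrite !muleA -!EFinM; congr (_%:E * _)%E.
  by rewrite mulrAC mulrCA mulrC; field; rewrite gt_eqF.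
apply: lee_wpmul2l; first by rewrite lee_fin mulr_ge0 ?powR_ge0// ltW.
by apply: ereal_sup_ubound; exists (t / C) => //=; rewrite divr_gt0.
Qed.

(** The product [weight (h x) * h x] is not simplified to [dual_factor (h x)]: where [h x = 0] the
    product is 0, whereas [dual_factor] takes a power of a negative base. *)
Lemma integral_weight nu h (f : T -> R) (B : set T) : admissible h -> is_density nu h ->
  measurable_fun setT f -> measurable B ->
  (\int[nu]_(x in B) `|f x * weight (h x)|%:E =
   \int[mu]_(x in B) (`|f x| * (weight (h x) * h x))%:E)%E.
Proof.
move=> ah nuh mf mB; have h0 := admissible_ge0 ah; have [mh _ _ _] := ah.
have mfW : measurable_fun B (fun x => `|f x * weight (h x)|%:E).
  apply/measurable_EFinP; apply: measurable_funTS; apply: measurableT_comp => //.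
  by apply: measurable_funM => //; exact: measurable_weight.
rewrite (ge0_integral_density mh h0 nuh mB mfW) => [|x]; last by rewrite lee_fin.
apply: eq_integral => x _.
by rewrite -EFinM normrM (ger0_norm (weight_ge0 (h0 x))) -[in LHS]mulrA.
Qed.

Lemma weight_rnorm_le nu h (f : T -> R) : admissible h -> is_density nu h ->
  measurable_fun setT f ->
  (weakLp_rnorm nu p 1 (fun x => f x * weight (h x))%R <= weakLp_rnorm mu p r f)%E.
Proof.
move=> ah nuh mf; have h0 := admissible_ge0 ah; have [mh _ hv _] := ah.
have a0 := alpha_gt0; have b0 := beta_gt0.
set N := weakLp_rnorm mu p r f.
have N0 : (0 <= N)%E by apply: ereal_sup_ubound; left.
apply: ge_ereal_sup => _ [->//|[B [mB /andP[nuB0 nuBy]] <-]].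
rewrite invr1 poweRe1; last first.
  by apply: integral_ge0 => x _; rewrite lee_fin powR_ge0.
under eq_integral do rewrite powRr1//.
rewrite (integral_weight ah nuh)//.
pose H := [set x | 0 < h x].
have mH : measurable H.
  by rewrite /H -[X in measurable X]setTI; exact: measurable_fun_ltr.
(* Both the density and the integrand vanish on [B] outside [D]. The set [D], rather than [B], will
   be the competitor in the supremum [N], since [mu B] may be infinite. *)
pose D := B `&` H; have mD : measurable D by exact: measurableI.
have Dh x : D x -> h x != 0 /\ alpha <= h x.
  move=> [_]; rewrite /H /= => hx; split; first by rewrite gt_eqF.
  by case: (hv x) => // hx0; move: hx; rewrite hx0 ltxx.
have offH x : ~ H x -> h x = 0.
  by rewrite /H /= => /negP; rewrite -leNgt => hx; apply/eqP; rewrite eq_le hx h0.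
have restr (k : T -> R) : (forall x, h x = 0 -> k x = 0) ->
    (\int[mu]_(x in B) (k x)%:E = \int[mu]_(x in D) (k x)%:E)%E.
  move=> k0; rewrite /D integral_mkcondr; apply: eq_integral => x _.
  by rewrite patchE; case: ifPn => //; rewrite notin_setE => /offH /k0 ->.
rewrite restr; last by move=> x ->; rewrite !mulr0.
(* On [D] this is phi^r', recovered from [h = alpha + beta * phi^r']. *)
pose g x := (h x - alpha) / beta.
have g0 x : D x -> 0 <= g x.
  by move=> /Dh[_ ax]; rewrite divr_ge0 ?subr_ge0// ltW.
have mg : measurable_fun setT g.
  by apply: measurable_funM => //; exact: measurable_funB.
have mgD : measurable_fun D (EFin \o g).
  by apply/measurable_EFinP; exact: measurable_funTS.
have gL0 : (0 <= \int[mu]_(x in D) (g x)%:E)%E.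
  by apply: integral_ge0 => x Dx; rewrite lee_fin g0.
have nuBE : (nu B = alpha%:E * mu D + beta%:E * \int[mu]_(x in D) (g x)%:E)%E.
  rewrite nuh// restr// -integral_cst// -ge0_integralZl//; last by exact: ltW.
  rewrite -ge0_integralD//.
  - apply: eq_integral => x /[!inE] Dx; rewrite -EFinM -EFinD; congr EFin.
    by rewrite /g; field; rewrite gt_eqF.
  - by move=> x _; rewrite lee_fin ltW.
  - by move=> x Dx; rewrite mule_ge0// lee_fin ?g0// ltW.
  - by apply: emeasurable_funM.
(* [nu B] is finite and [alpha], [beta] are positive, so both summands in [nuBE] are finite. *)
have muDy : (mu D < +oo)%E.
  rewrite ltey; apply/eqP => muDy; move: nuBy; rewrite nuBE muDy gt0_muley ?lte_fin//.
  by rewrite addye// gt_eqF// (lt_le_trans (ltNyr 0))// mule_ge0// lee_fin ltW.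
have gLy : (\int[mu]_(x in D) (g x)%:E < +oo)%E.
  rewrite ltey; apply/eqP => gy; move: nuBy; rewrite nuBE gy gt0_muley ?lte_fin//.
  by rewrite addey// gt_eqF// (lt_le_trans (ltNyr 0))// mule_ge0// lee_fin ltW.
have muDf : mu D \is a fin_num by rewrite ge0_fin_numE.
have gLf : (\int[mu]_(x in D) (g x)%:E)%E \is a fin_num by rewrite ge0_fin_numE.
set a := fine (mu D); set l := fine (\int[mu]_(x in D) (g x)%:E)%E.
have aE : mu D = a%:E by rewrite fineK.
have lE : (\int[mu]_(x in D) (g x)%:E = l%:E)%E by rewrite fineK.
have muD0 : (0 < mu D)%E.
  rewrite lt0e measure_ge0 andbT; apply/eqP => muD0.
  move: nuB0; rewrite nuh// restr// null_set_integral ?ltxx//.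
  by apply/measurable_EFinP; exact: measurable_funTS.
have ap : 0 < a by rewrite -lte_fin -aE.
have l0 : 0 <= l by rewrite -lee_fin -lE.
set b := fine (nu B).
have bE : b = alpha * a + beta * l.
  by rewrite /b nuBE aE lE.
have bp : 0 < b by rewrite fine_gt0// nuB0.
(* Hoelder with exponents [r] and r' = [(1 - r^-1)^-1]; the r'-th power of [dual_factor (h x)] is
   [g x]. *)
have step1 : (\int[mu]_(x in D) (`|f x| * (weight (h x) * h x))%:E <=
   poweR (\int[mu]_(x in D) (`|f x| `^ r)%:E) r^-1 * (l `^ (1 - r^-1))%:E)%E.
  have := @hoelder_on _ _ _ mu f (dual_factor \o h) r (1 - r^-1)^-1 D mD.
  move=> /(_ (measurable_funTS mf) (measurable_funTS (measurable_dual_factor mh)) r0).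
  rewrite invr_gt0 v_gt0 invrK addrC subrK => /(_ isT erefl).
  under [X in poweR X (1 - r^-1)]eq_integral => x xD.
    rewrite /= ger0_norm ?powR_ge0// dual_factor_powR; last by move: xD; rewrite inE => /Dh[].
    over.
  rewrite lE poweR_EFin; apply: le_trans.
  rewrite le_eqVlt; apply/orP; left; apply/eqP; apply: eq_integral => x /[!inE] Dx.
  by rewrite weightK ?(Dh _ Dx).1//= (ger0_norm (powR_ge0 _ (1 - r^-1))).
have step2 : ((a `^ (p^-1 - r^-1))%:E *
   poweR (\int[mu]_(x in D) (`|f x| `^ r)%:E) r^-1 <= N)%E.
  by apply: ereal_sup_ubound; right; exists D => //; split => //; rewrite muD0.
have step3 : a `^ (r^-1 - p^-1) * l `^ (1 - r^-1) <= b `^ (1 - p^-1).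
  have := powR_weighted_AMGM (ltW ap) l0 u_gt0 v_gt0.
  by rewrite uvw bE.
set X := poweR (\int[mu]_(x in D) (`|f x| `^ r)%:E)%E r^-1 in step1 step2.
have X0 : (0 <= X)%E by exact: poweR_ge0.
apply: (@le_trans _ _ ((b `^ (p^-1 - 1))%:E * (X * (l `^ (1 - r^-1))%:E))%E).
  by apply: lee_wpmul2l => //; rewrite lee_fin powR_ge0.
(* The inserted factors multiply to 1. They split off the competitor of [D], at most [N] by [step2];
   what remains is a constant that [step3] bounds by 1. *)
have -> : X = ((a `^ (r^-1 - p^-1))%:E * ((a `^ (p^-1 - r^-1))%:E * X))%E.
  rewrite muleA -EFinM -powRD; last by rewrite (gt_eqF ap) implybT.
  by rewrite (_ : _ + _ = 0) ?powRr0 ?mul1e//; ring.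
set Y := ((a `^ (p^-1 - r^-1))%:E * X)%E in step2 *.
have -> : ((b `^ (p^-1 - 1))%:E * ((a `^ (r^-1 - p^-1))%:E * Y * (l `^ (1 - r^-1))%:E) =
  (b `^ (p^-1 - 1) * (a `^ (r^-1 - p^-1) * l `^ (1 - r^-1)))%:E * Y)%E.
  by rewrite [X in (_ * X)%E]muleAC -EFinM muleA -EFinM.
have Y0 : (0 <= Y)%E by rewrite mule_ge0// lee_fin powR_ge0.
rewrite -[leRHS]mul1e; apply: lee_pmul => //.
  by rewrite lee_fin !mulr_ge0 ?powR_ge0.
rewrite lee_fin (le_trans (ler_wpM2l (powR_ge0 _ _) step3))//.
rewrite -powRD; last by rewrite (gt_eqF bp) implybT.
by rewrite (_ : _ + _ = 0) ?powRr0//; ring.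
Qed.


(** * Attaining the norm *)

(** The maps are indexed by measures, not by densities. This makes the map of [nu] independent, up
    to null sets, of which admissible density is selected. *)
Lemma density_unique nu h h' : admissible h -> is_density nu h ->
  admissible h' -> is_density nu h' ->
  ae_eq mu setT (EFin \o h) (EFin \o h').
Proof.
move=> [_ ih _ _] nuh [mh' _ _ _] nuh'; apply: integral_ae_eq => //.
  exact/measurable_EFinP.
by move=> E _ mE; rewrite -[LHS]nuh// -[RHS]nuh'.
Qed.

(** The equality case of the two inequalities, with [g] a bounded minorant standing for the
    truncation of [|f|]. The bound covers every admissible density of [nu], because the final
    embedding selects one by choice. *)
Lemma le_weight_rnorm (f g : T -> R) (A : set T) (n : R) :
  measurable_fun setT f -> measurable_fun setT g ->
  (forall x, 0 <= g x) -> (forall x, g x <= `|f x|) -> (forall x, g x <= n) ->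
  measurable A -> (0 < mu A < +oo)%E ->
  (0 < \int[mu]_(x in A) (g x `^ r)%:E)%E ->
  exists2 nu, exists2 h, admissible h & is_density nu h &
  forall h', admissible h' -> is_density nu h' ->
   ((fine (mu A) `^ (p^-1 - r^-1))%:E *
      poweR (\int[mu]_(x in A) (g x `^ r)%:E) r^-1 <=
    weakLp_rnorm nu p 1 (fun x => f x * weight (h' x))%R)%E.
Proof.
move=> mf mg g0 gf gn mA /andP[muA0 muAy] I0.
have al0 := alpha_gt0; have be0 := beta_gt0.
set a := fine (mu A).
have aE : mu A = a%:E by rewrite fineK// ge0_fin_numE.
have a0 : 0 < a by rewrite -lte_fin -aE.
have mgr : measurable_fun setT (fun x => g x `^ r).
  exact: (measurableT_comp (measurable_powR _)).
have mgrA : measurable_fun A (fun x => (g x `^ r)%:E).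
  by apply/measurable_EFinP; exact: measurable_funTS.
have grn x : g x `^ r <= n `^ r.
  by apply: ge0_ler_powR; rewrite ?nnegrE ?(ltW r0)// (le_trans (g0 x)).
set I := (\int[mu]_(x in A) (g x `^ r)%:E)%E in I0 *.
have Iy : (I < +oo)%E.
  apply: (@le_lt_trans _ _ (\int[mu]_(x in A) (cst (n `^ r)%:E x)))%E.
    apply: ge0_le_integral => //.
    - by move=> x _; rewrite lee_fin powR_ge0.
    - by move=> x _; rewrite lee_fin.
  by rewrite integral_cst// aE -EFinM ltry.
set i := fine I.
have IE : I = i%:E by rewrite fineK// ge0_fin_numE// ltW.
have i0 : 0 < i by rewrite -lte_fin -IE.
pose c := a / i; have c0 : 0 < c by rewrite divr_gt0.
pose k x := alpha + beta * (c * g x `^ r).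
have bc0 y : 0 <= y -> 0 <= beta * (c * y).
  by move=> y0; apply: mulr_ge0; [exact: ltW|apply: mulr_ge0 => //; exact: ltW].
have kal x : alpha <= k x by rewrite lerDl bc0// powR_ge0.
have k0 x : 0 <= k x by rewrite (le_trans (ltW al0)).
have mk : measurable_fun setT k.
  by apply: measurable_funD => //; apply: measurable_funM => //; exact: measurable_funM.
pose K := alpha + beta * (c * n `^ r).
have kK x : k x <= K by rewrite lerD2l ler_pM2l// ler_pM2l.
pose h x := \1_A x * k x.
have mh : measurable_fun setT h by apply: measurable_funM.
have h0 x : 0 <= h x by rewrite mulr_ge0.
have hA x : A x -> h x = k x by move=> Ax; rewrite /h indicE mem_set// mul1r.
have hnA x : ~ A x -> h x = 0 by move=> Ax; rewrite /h indicE memNset// mul0r.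
have hle x : h x <= K * \1_A x.
  have [Ax|Ax] := pselect (A x).
    by rewrite hA// indicE mem_set// mulr1.
  by rewrite hnA// indicE memNset// mulr0.
have adh : admissible h.
  split => //.
  - apply/integrableP; split; first exact/measurable_EFinP.
    apply: (@le_lt_trans _ _ (\int[mu]_x (K * \1_A x)%:E))%E.
      apply: ge0_le_integral => //.
      + by do 2 apply: measurableT_comp => //.
      + by apply/measurable_EFinP; exact: measurable_funM.
      + by move=> x _; rewrite /= lee_fin ger0_norm.
    under eq_integral do rewrite EFinM.
    have K0 : 0 <= K by rewrite (le_trans (ltW al0))// lerDl bc0// powR_ge0.
    have mI : measurable_fun setT (fun x => (\1_A x)%:E : \bar R).
      exact/measurable_EFinP.
    by rewrite ge0_integralZl// integral_indic// setIT aE -EFinM ltry.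
  - by move=> x; have [/hA ->|/hnA ->] := pselect (A x); [right|left].
  - exists K => x; have [/hA ->//|/hnA ->] := pselect (A x).
    exact: le_trans (k0 x) (kK x).
have [nu nuh] := exists_density_measure mu mh h0.
have nuh' : is_density nu h by move=> B _; exact: nuh.
exists nu; first by exists h.
move=> h1 ah1 nuh1.
have nuA : nu A = a%:E.
  rewrite nuh.
  transitivity (\int[mu]_(x in A) (alpha%:E + (beta * c)%:E * (g x `^ r)%:E))%E.
    by apply: eq_integral => x /[!inE] Ax; rewrite hA// /k mulrA.
  have bc : 0 <= beta * c by rewrite -[c]mulr1 bc0.
  have gr0 x : A x -> (0 <= (g x `^ r)%:E)%E by rewrite lee_fin powR_ge0.
  have bgr0 x : A x -> (0 <= (beta * c)%:E * (g x `^ r)%:E)%E.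
    by move=> Ax; rewrite mule_ge0 ?gr0.
  have al1 x : A x -> (0 <= alpha%:E)%E by rewrite lee_fin ltW.
  have mbgr : measurable_fun A (fun x => (beta * c)%:E * (g x `^ r)%:E)%E.
    exact: emeasurable_funM.
  rewrite ge0_integralD// ge0_integralZl//.
  rewrite integral_cst// -/I IE aE -!EFinM -EFinD; congr EFin.
  by rewrite -[beta * c * i]mulrA /c divfK ?gt_eqF// -mulrDl alphaDbeta mul1r.
apply: (@le_trans _ _ ((fine (nu A) `^ (p^-1 - 1^-1))%:E *
  poweR (\int[nu]_(x in A) (`|f x * weight (h1 x)| `^ 1)%:E) 1^-1)%E); last first.
  by apply: ereal_sup_ubound; right; exists A => //; split => //; rewrite nuA ltry lte_fin a0.
rewrite invr1 poweRe1; last first.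
  by apply: integral_ge0 => x _; rewrite lee_fin powR_ge0.
under eq_integral do rewrite powRr1//.
rewrite (integral_weight ah1 nuh1)// nuA /=.
have h10 := admissible_ge0 ah1; have [mh1 _ _ _] := ah1.
have mF (h2 : T -> R) : measurable_fun setT h2 -> (forall x, 0 <= h2 x) ->
    measurable_fun A (fun x => (`|f x| * (weight (h2 x) * h2 x))%:E).
  move=> mh2 h20; apply/measurable_EFinP; apply: measurable_funTS.
  apply: measurable_funM; first exact: measurableT_comp.
  by apply: measurable_funM => //; exact: measurable_weight.
have F0 (h2 : T -> R) : (forall x, 0 <= h2 x) -> forall x, A x ->
    (0 <= (`|f x| * (weight (h2 x) * h2 x))%:E)%E.
  by move=> h20 x _; rewrite lee_fin mulr_ge0// mulr_ge0// weight_ge0.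
have -> : (\int[mu]_(x in A) (`|f x| * (weight (h1 x) * h1 x))%:E =
  \int[mu]_(x in A) (`|f x| * (weight (h x) * h x))%:E)%E.
  apply: ge0_ae_eq_integral; [by []|exact: mF|exact: mF|exact: F0|exact: F0|].
  apply: filterS (density_unique ah1 nuh1 adh nuh') => x /= /(_ Logic.I) [->].
  by [].
(* On [A] the dual factor is [c]^ (1 - r^-1) * g x [^ (r - 1)], and [g x <= |f x|] supplies the
   missing power of [g x]. *)
have step : ((c `^ (1 - r^-1) * i)%:E <=
    \int[mu]_(x in A) (`|f x| * (weight (h x) * h x))%:E)%E.
  rewrite EFinM -IE -ge0_integralZl//; last first.
  - by rewrite lee_fin powR_ge0.
  - by move=> x _; rewrite lee_fin powR_ge0.
  apply: ge0_le_integral => //.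
  - by move=> x _; rewrite lee_fin mulr_ge0 ?powR_ge0.
  - exact: emeasurable_funM.
  - exact: mF.
  - move=> x Ax; rewrite hA// weightK; last by rewrite gt_eqF// (lt_le_trans al0).
    have -> : dual_factor (k x) = c `^ (1 - r^-1) * g x `^ (r - 1).
      rewrite /dual_factor /k [X in X `^ _](_ : _ = c * g x `^ r); last first.
        by rewrite addrAC subrr add0r mulrC mulKf// gt_eqF.
      by rewrite powRM ?(ltW c0) ?powR_ge0// -powRrM mulrBr mulr1 divff ?gt_eqF.
    rewrite lee_fin.
    rewrite mulrCA ler_wpM2l ?powR_ge0// -mulr_powRB1//.
    by rewrite ler_wpM2r ?powR_ge0.
apply: le_trans (lee_wpmul2l _ step); last by rewrite lee_fin powR_ge0.
rewrite IE poweR_EFin -!EFinM lee_fin le_eqVlt; apply/orP; left; apply/eqP.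
have -> : c `^ (1 - r^-1) * i = a `^ (1 - r^-1) * i `^ r^-1.
  rewrite /c powRM ?invr_ge0 ?(ltW a0) ?(ltW i0)// -mulrA; congr (_ * _).
  rewrite -[i^-1]powR_inv1 ?(ltW i0)// -powRrM -[X in _ * X](powRr1 (ltW i0)).
  by rewrite -powRD ?(gt_eqF i0) ?implybT//; congr (_ `^ _); ring.
rewrite mulrA -powRD ?(gt_eqF a0) ?implybT//.
by congr (_ `^ _ * _); ring.
Qed.

(** * The family of measures and the isometry *)

Lemma exists_isometric_weights : exists Gamma : set {measure set T -> \bar R},
  exists H : {measure set T -> \bar R} -> T -> R,
  (forall nu, Gamma nu -> admissible (H nu) /\ is_density nu (H nu)) /\
  forall f : T -> R, measurable_fun setT f ->
   ereal_sup ([set 0%E] `|` [set weakLp_rnorm nu p 1 (fun x => f x * weight (H nu x))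
      | nu in Gamma]) = weakLp_rnorm mu p r f.
Proof.
pose Gamma : set {measure set T -> \bar R} :=
  [set nu | exists2 h, admissible h & is_density nu h].
(* The implication makes the statement total in [nu], so that choice yields a function [H]; its
   values outside [Gamma] are arbitrary. *)
have Hex (nu : {measure set T -> \bar R}) : exists h, Gamma nu -> admissible h /\ is_density nu h.
  have [[h ah nuh]|nG] := pselect (Gamma nu); first by exists h.
  by exists (cst 0).
have [H HP] := choice Hex; exists Gamma, H; split => // f mf.
apply/eqP; rewrite eq_le; apply/andP; split.
  apply: ge_ereal_sup => _ [->|[nu /HP[ah nuh] <-]]; last exact: weight_rnorm_le.
  by apply: ereal_sup_ubound; left.
set S := ereal_sup _.
have S0 : (0 <= S)%E by apply: ereal_sup_ubound; left.
apply: ge_ereal_sup => _ [->//|[A [mA muA] <-]].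
have [->|Sy] := eqVneq S +oo%E; first by rewrite leey.
have SE : S = (fine S)%:E by rewrite fineK// ge0_fin_numE// ltey.
have a0 : 0 < fine (mu A) by rewrite fine_gt0.
set a := fine (mu A) in a0 *; set e := p^-1 - r^-1.
have ae0 : 0 < a `^ e by rewrite powR_gt0.
have rV0 : 0 < r^-1 by rewrite invr_gt0.
(* Solving for the integral puts the bound in the form of the truncation lemma. It is used once to
   reach the truncations and once to return; [S] must be finite for this. *)
have iff (J : \bar R) : (0 <= J)%E -> ((a `^ e)%:E * poweR J r^-1 <= S)%E <->
    (J <= (((a `^ e)^-1 * fine S) `^ r)%:E)%E.
  move=> J0; rewrite {1}SE.
  have s0 : 0 <= (a `^ e)^-1 * fine S by rewrite mulr_ge0 ?invr_ge0 ?powR_ge0 ?fine_ge0.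
  have -> : ((a `^ e)%:E * poweR J r^-1 <= (fine S)%:E)%E =
     (poweR J r^-1 <= ((a `^ e)^-1 * fine S)%:E)%E.
    by rewrite EFinM lee_pdivlMl.
  split => le.
    have -> : J = poweR (poweR J r^-1) r by rewrite -poweRrM mulVf ?gt_eqF// poweRe1.
    rewrite -poweR_EFin; apply: gt0_ler_poweR => //; first exact: ltW.
      by rewrite in_itv/= poweR_ge0 leey.
    by rewrite in_itv/= lee_fin s0 leey.
  have -> : ((a `^ e)^-1 * fine S)%:E =
      poweR (((a `^ e)^-1 * fine S) `^ r)%:E r^-1.
    by rewrite poweR_EFin -powRrM divff ?gt_eqF// powRr1.
  apply: gt0_ler_poweR => //; first exact: ltW.
    by rewrite in_itv/= J0 leey.
  by rewrite in_itv/= lee_fin powR_ge0 leey.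
apply/iff; first by apply: integral_ge0 => x _; rewrite lee_fin powR_ge0.
apply: integral_powR_truncation_le => //; first exact: measurable_funTS.
move=> n; apply/iff; first by apply: integral_ge0 => x _; rewrite lee_fin powR_ge0.
have : (0 <= \int[mu]_(x in A) (Num.min `|f x| n%:R `^ r)%:E)%E.
  by apply: integral_ge0 => x _; rewrite lee_fin powR_ge0.
(* A vanishing truncated integral is set apart, since [le_weight_rnorm] divides by it. *)
rewrite le_eqVlt => /orP[/eqP <-|I0].
  by rewrite poweR0r ?gt_eqF// mule0.
have mg : measurable_fun setT (fun x => Num.min `|f x| n%:R).
  by apply: measurable_minr => //; exact: measurableT_comp.
have [] := @le_weight_rnorm f (fun x => Num.min `|f x| n%:R) A n%:R mf mg _ _ _ mA muA I0.
- by move=> x; rewrite le_min normr_ge0 ler0n.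
- by move=> x; rewrite ge_min lexx.
- by move=> x; rewrite ge_min lexx orbT.
move=> nu Gnu le; have [ah nuh] := HP nu Gnu.
apply: (le_trans (le _ ah nuh)).
by apply: ereal_sup_ubound; right; exists nu.
Qed.

End weighted_embedding.

Unset Implicit Arguments.
Set Strict Implicit.

Theorem mainTheorem13 (R : realType) (d : measure_display) (T : measurableType d)
  (mu : {measure set T -> \bar R}) (r p : R) :
  1 < r -> r < p ->
  exists (Gamma : set {measure set T -> \bar R})
         (J : (T -> R) -> {measure set T -> \bar R} -> T -> R),
    (* J maps L^{p,oo}(mu) into the product of the L^{p,oo}(nu), nu in Gamma *)
    (forall f, weakLp mu p f -> forall nu, Gamma nu -> weakLp nu p (J f nu)) /\
    (* linearity (coordinatewise, a.e.) *)
    (forall f g (a b : R), weakLp mu p f -> weakLp mu p g ->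
       forall nu, Gamma nu ->
       {ae nu, forall x, J (fun y => a * f y + b * g y) nu x
                         = a * J f nu x + b * J g nu x}) /\
    (* lattice homomorphism (coordinatewise, a.e.) *)
    (forall f g, weakLp mu p f -> weakLp mu p g ->
       forall nu, Gamma nu ->
       {ae nu, forall x, J (fun y => Num.max (f y) (g y)) nu x
                         = Num.max (J f nu x) (J g nu x)}) /\
    (* isometry onto the l_oo-sum norm *)
    (forall f, weakLp mu p f ->
       ereal_sup ([set 0%E] `|` [set weakLp_rnorm nu p 1 (J f nu) | nu in Gamma])
       = weakLp_rnorm mu p r f).
Proof.
move=> r1 rp; have [Gamma [H [HP HE]]] := exists_isometric_weights mu r1 rp.
exists Gamma, (fun f nu x => f x * weight r p (H nu x)).
split; [|split; [|split]].
- by move=> f wf nu /HP[ah nuh]; exact: weakLp_weight ah nuh wf.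
(* Each coordinate is multiplication by a fixed nonnegative function, so linearity and preservation
   of maxima hold at every point. *)
- by move=> f g a b _ _ nu _; apply/nearW => x; rewrite mulrDl !mulrA.
- move=> f g _ _ nu /HP[ah _]; apply/nearW => x; rewrite maxr_pMl//.
  exact/weight_ge0/(admissible_ge0 r1 rp ah).
- by move=> f [mf _]; exact: HE.
Qed.
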